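(* Let $A$ be a commutative $\mathbb{R}$-algebra with $1$, let $M$ be a quadratic module of $A$, let $f\in A$ and $a,b\in\mathbb{R}$. (1) If $a<f<b$ on $\mathcal{Y}_M$, then $b-f\in M^{\ddagger}$ and $f-a\in M^{\ddagger}$. (2) If $A$ has countable vector space dimension over $\mathbb{R}$ and $b-f,\ f-a\in\overline{M}$, then $$\overline{M}=\bigcap_{a\le\lambda\le b}\overline{M_\lambda},\qquad\text{where } M_\lambda:=M+(f-\lambda)$$ and $(f-\lambda)$ denotes the ideal of $A$ generated by $f-\lambda$.
   Context: A quadratic module of $A$ is a subset $Q\subseteq A$ with $Q+Q\subseteq Q$, $f^2Q\subseteq Q$ for all $f\in A$, and $1\in Q$. A semiordering of $A$ is a quadratic module $Q$ of $A$ such that $Q\cup -Q=A$ and $Q\cap -Q$ is a prime ideal of $A$. $\mathcal{Y}_M$ is the set of all semiorderings of $A$ containing $M$. For $g\in A$, ''$g>0$ on $\mathcal{Y}_M$'' means $g\in Q$ and $g\notin -Q$ for every $Q\in\mathcal{Y}_M$; ''$a<f<b$ on $\mathcal{Y}_M$'' means $f-a>0$ and $b-f>0$ on $\mathcal{Y}_M$. $A$ is endowed, as a real vector space, with the finest locally convex topology (the vector space topology for which all convex, absorbent, symmetric subsets form a zero neighborhood base; $U$ is absorbent if for each $x$ there is $\lambda>0$ with $x\in\lambda U$, and symmetric if $\lambda U\subseteq U$ for all $|\lambda|\le 1$). For $C\subseteq A$, $\overline{C}$ is the closure of $C$ in this topology, and $C^{\ddagger}$ (the sequential closure) is the set of all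 elements of $A$ that are limits of sequences of elements of $C$. An intersection over the empty family is understood to be $A$. *)

(* Defs.v *)
From HB Require Import structures.
From mathcomp Require Import all_boot all_order all_algebra.
From mathcomp Require Import all_classical all_reals all_analysis.

Set Implicit Arguments.
Unset Strict Implicit.
Unset Printing Implicit Defensive.

Import Order.TTheory GRing.Theory Num.Theory.
Import numFieldNormedType.Exports.

Local Open Scope classical_set_scope.
Local Open Scope ring_scope.

Section FinestLocallyConvexTopology.
Context {R : realType} {E : lmodType R}.
Implicit Types (U V B : set E) (x y : E).

Definition absorbent U : Prop :=
  forall x, exists2 l : R, 0 < l & [set l *: u | u in U] x.

Definition symmetric_set U : Prop :=
  forall l : R, `|l| <= 1 -> [set l *: u | u in U] `<=` U.

Definition flc_base : set (set E) :=
  [set U | [/\ convex_set U, absorbent U & symmetric_set U]].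

(* Translates of the zero neighborhood base. *)
Definition flc_nbhs x : set_system E :=
  filter_from flc_base (fun U => [set x + u | u in U]).

Lemma convex_setP U : convex_set U <->
  forall x y (l : R), 0 <= l <= 1 -> U x -> U y -> U (l *: x + (1 - l) *: y).
Proof.
split=> [cU x y l /andP[l0 l1] Ux Uy|cU x y l].
  have /= := cU x y (Itv01 l0 l1) (mem_set Ux) (mem_set Uy).
  exact: set_mem.
move=> /set_mem Ux /set_mem Uy; apply/mem_set; apply: cU => //.
by rewrite ge0 le1.
Qed.

Lemma flc_base0 U : flc_base U -> U 0.
Proof.
move=> [_ aU sU]; have [l l0 [u Uu _]] := aU 0.
by apply: (sU 0); [rewrite normr0|exists u => //; rewrite scale0r].
Qed.

Lemma flc_baseT : flc_base setT.
Proof.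
split; [by apply/convex_setP| |by []].
by move=> x; exists 1 => //; exists x => //; rewrite scale1r.
Qed.

Lemma flc_base_scale U x (l m : R) : flc_base U -> U x ->
  `|l| <= `|m| -> [set m *: u | u in U] (l *: x).
Proof.
move=> [_ _ sU] Ux lm; have [m0|m0] := eqVneq m 0.
  move: lm; rewrite m0 normr0 normr_le0 => /eqP->.
  by exists x => //; rewrite !scale0r.
exists ((l / m) *: x); last by rewrite scalerA mulrC divfK.
apply: (sU (l / m)); last by exists x.
by rewrite normrM normfV ler_pdivrMr ?normr_gt0// mul1r.
Qed.

Lemma flc_baseI U V : flc_base U -> flc_base V -> flc_base (U `&` V).
Proof.
move=> bU bV; have [/convex_setP cU aU sU] := bU; have [/convex_setP cV aV sV] := bV.
split.
- by apply/convex_setP => x y l l01 [Ux Vx] [Uy Vy]; split; [exact: cU|exact: cV].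
- move=> x; have [l l0 [u Uu ux]] := aU x; have [m m0 [v Vv vx]] := aV x.
  have lm0 : 0 < l + m by rewrite addr_gt0.
  exists (l + m) => //; exists ((l + m)^-1 *: x).
    have gen W w k : flc_base W -> W w -> 0 < k -> k <= l + m -> k *: w = x ->
        W ((l + m)^-1 *: x).
      move=> bW Ww k0 klm <-.
      have := @flc_base_scale W w k (l + m) bW Ww.
      rewrite !gtr0_norm// => /(_ klm) [w' Ww' <-].
      by rewrite scalerA mulVf ?gt_eqF// scale1r.
    split; first by apply: (gen U u l) => //; rewrite lerDl ltW.
    by apply: (gen V v m) => //; rewrite lerDr ltW.
  by rewrite scalerA mulfV ?gt_eqF// scale1r.
- move=> l l1 _ [x [Ux Vx] <-]; split; [apply: (sU l) => //|apply: (sV l) => //];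
  by exists x.
Qed.

Lemma flc_baseZ U (k : R) : 0 < k -> flc_base U -> flc_base [set k *: u | u in U].
Proof.
move=> k0 bU; have [/convex_setP cU aU sU] := bU; split.
- apply/convex_setP => _ _ l l01 [x Ux <-] [y Uy <-].
  exists (l *: x + (1 - l) *: y); first exact: cU.
  by rewrite scalerDr !scalerA mulrC [k * (1 - l)]mulrC.
- move=> x; have [l l0 [u Uu <-]] := aU x.
  exists (l / k); first by rewrite divr_gt0.
  exists (k *: u); first by exists u.
  by rewrite scalerA divfK ?gt_eqF.
- move=> l l1 _ [_ [x Ux <-] <-]; exists (l *: x).
    by apply: (sU l) => //; exists x.
  by rewrite !scalerA mulrC.
Qed.

Lemma flc_base_half U x y : flc_base U ->
  [set 2^-1 *: u | u in U] x -> [set 2^-1 *: u | u in U] y -> U (x + y).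
Proof.
move=> [/convex_setP cU _ _] [u Uu <-] [v Uv <-].
have h : 1 - 2^-1 = 2^-1 :> R.
  by apply/eqP; rewrite subr_eq -(div1r 2) -splitr.
have := @cU u v 2^-1; rewrite h; apply => //.
by rewrite invr_ge0 ler0n/= invf_le1// ler1n.
Qed.

Lemma flc_nbhs_filter x : ProperFilter (flc_nbhs x).
Proof.
apply: filter_from_proper; last first.
  by move=> U /flc_base0 U0; exists x; exists 0; rewrite ?addr0.
apply: filter_from_filter; first by exists setT; exact: flc_baseT.
move=> U V bU bV; exists (U `&` V); first exact: flc_baseI.
by move=> _ [u [Uu Vu] <-]; split; exists u.
Qed.

Lemma flc_nbhs_singleton x B : flc_nbhs x B -> B x.
Proof.
by move=> [U /flc_base0 U0 UB]; apply: UB; exists 0 => //; rewrite addr0.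
Qed.

Lemma flc_nbhs_nbhs x B : flc_nbhs x B -> flc_nbhs x (flc_nbhs^~ B).
Proof.
move=> [U bU UB]; have b2 := @flc_baseZ U 2^-1 ltac:(by []) bU.
exists [set 2^-1 *: u | u in U] => // _ [y Uy <-].
exists [set 2^-1 *: u | u in U] => // _ [z Uz <-].
by apply: UB; exists (y + z); rewrite ?addrA//; exact: flc_base_half.
Qed.

End FinestLocallyConvexTopology.

(* E with the finest locally convex topology; an alias because E may already
   carry a topology. *)
Definition finest_lc (R : realType) (E : lmodType R) : Type := E.

HB.instance Definition _ (R : realType) (E : lmodType R) :=
  GRing.Lmodule.on (finest_lc E).
HB.instance Definition _ (R : realType) (E : lmodType R) :=
  hasNbhs.Build (finest_lc E) (@flc_nbhs R E).
HB.instance Definition _ (R : realType) (E : lmodType R) :=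
  Nbhs_isNbhsTopological.Build (finest_lc E) (@flc_nbhs_filter R E)
    (@flc_nbhs_singleton R E) (@flc_nbhs_nbhs R E).


Section FinestLocallyConvexTvs.
Context {R : realType} {E : lmodType R}.
Local Notation T := (finest_lc E).

Let flc_add_continuous : continuous (fun x : T * T => x.1 + x.2).
Proof.
move=> [x y] B [U bU UB].
have nb z : nbhs (z : T) [set z + u | u in [set 2^-1 *: u | u in U]].
  by exists [set 2^-1 *: u | u in U] => //; exact: flc_baseZ.
exists ([set x + u | u in [set 2^-1 *: u | u in U]],
        [set y + u | u in [set 2^-1 *: u | u in U]]); first by split; apply: nb.
move=> [_ _] /= [[u hu <-] [v hv <-]]; apply: UB; exists (u + v).
  exact: flc_base_half.
by rewrite addrACA.
Qed.

Let flc_scale_continuous : continuous (fun z : R^o * T => z.1 *: z.2).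
Proof.
move=> [k x] B [U bU UB].
have b2 : flc_base [set 2^-1 *: u | u in U] by exact: flc_baseZ.
have [_ aU s2] := b2.
have [m m0 [w hw wx]] := aU x.
pose e := Num.min 1 m^-1.
have e0 : 0 < e by rewrite lt_min ltr01 invr_gt0.
have k0 : 0 < `|k| + 1 by rewrite ltr_wpDl.
pose W := [set (`|k| + 1)^-1 *: u | u in [set 2^-1 *: u | u in U]].
have bW : flc_base W.
  by apply: flc_baseZ; rewrite ?invr_gt0//; exact: flc_baseZ.
exists (ball (k : R^o) e, [set x + u | u in W]).
  by split; [exact: nbhsx_ballx|exists W].
move=> [l _] /= [kl [_ [u hu <-] <-]].
have kle : `|l - k| < e by rewrite distrC.
apply: UB; exists ((l - k) *: x + l *: ((`|k| + 1)^-1 *: u)); last first.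
  by rewrite /= addrA -scalerDl [k + _]addrC subrK -scalerDr.
apply: flc_base_half => //.
- rewrite -wx scalerA; apply: (s2 ((l - k) * m)); last by exists w.
  rewrite normrM (gtr0_norm m0) -ler_pdivlMr// div1r.
  by rewrite (le_trans (ltW kle))// ge_min lexx orbT.
- rewrite scalerA; apply: (s2 (l / (`|k| + 1))); last by exists u.
  rewrite normrM normfV (gtr0_norm k0) ler_pdivrMr// mul1r.
  rewrite -(subrK k l) (le_trans (ler_normD _ _))// addrC lerD2l.
  by rewrite (le_trans (ltW kle))// ge_min lexx.
Qed.

Let flc_locally_convex :
  exists2 B : set_system T, (forall b, b \in B -> convex_set b) & basis B.
Proof.
exists [set b : set T | open b /\ convex_set b].
  by move=> b /set_mem[].
split=> [b []//|x V [U bU UV]].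
exists ((([set x + u | u in U] : set T)°)%classic); last first.
  by move=> z /interior_subset/UV.
split; last by exists U.
split; first exact: open_interior.
have [/convex_setP cU _ _] := bU.
apply/convex_setP => y z l l01 [V1 bV1 V1U] [V2 bV2 V2U].
exists (V1 `&` V2); first exact: flc_baseI.
move=> _ [v [v1 v2] <-].
have /V1U [u1 Uu1 e1] : [set y + u | u in V1] (y + v) by exists v.
have /V2U [u2 Uu2 e2] : [set z + u | u in V2] (z + v) by exists v.
exists (l *: u1 + (1 - l) *: u2); first exact: cU.
have avg (t : E) : l *: t + (1 - l) *: t = t.
  by rewrite -scalerDl addrC subrK scale1r.
rewrite -[X in X + _ = _](avg x) addrACA -!scalerDr e1 e2 !scalerDr addrACA.
by rewrite avg.
Qed.

HB.instance Definition _ := PreTopologicalLmod_isTvs.Build R T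
  flc_add_continuous flc_scale_continuous flc_locally_convex.

End FinestLocallyConvexTvs.

Definition flc_closure (R : realType) (E : lmodType R) (C : set E) : set E :=
  @closure (finest_lc E) C.

Definition flc_seq_closure (R : realType) (E : lmodType R) (C : set E) :
    set E :=
  [set x | exists2 u : nat -> finest_lc E,
     (forall n, C (u n)) & u n @[n --> \oo] --> (x : finest_lc E)].

(* "Countable" includes "finite". *)
Definition countable_dimension (R : realType) (E : lmodType R) : Prop :=
  exists B : set E,
    [/\ countable B,
        (forall (s : seq E) (c : E -> R), uniq s -> (forall v, v \in s -> B v) ->
           \sum_(v <- s) c v *: v = 0 -> forall v, v \in s -> c v = 0) &
        (forall x : E, exists (s : seq E) (c : E -> R),
           (forall v, v \in s -> B v) /\ x = \sum_(v <- s) c v *: v)].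

Section QuadraticModules.
Context {A : comNzRingType}.
Implicit Types (Q M I : set A) (f g : A).

Definition quadratic_module Q : Prop :=
  [/\ forall p q, Q p -> Q q -> Q (p + q),
      forall f q, Q q -> Q (f ^+ 2 * q)
    & Q 1].

Definition opp_set Q : set A := [set - q | q in Q].

Definition prime_ideal I : Prop :=
  idealr_closed (mem I) /\ prime_idealr_closed (mem I).

Definition semiordering Q : Prop :=
  [/\ quadratic_module Q, Q `|` opp_set Q = setT
    & prime_ideal (Q `&` opp_set Q)].

Definition semiorderings_over M : set (set A) :=
  [set Q | semiordering Q /\ M `<=` Q].

Definition pos_on (Y : set (set A)) g : Prop :=
  forall Q, Y Q -> Q g /\ ~ opp_set Q g.

(* Not idealr_closed, which excludes the unit ideal. *)
Definition ideal I : Prop :=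
  [/\ I 0, forall x y, I x -> I y -> I (x + y) & forall a x, I x -> I (a * x)].

Definition ideal_gen g : set A := smallest ideal [set g].

Definition add_ideal_gen M g : set A := [set m + h | m in M & h in ideal_gen g].

End QuadraticModules.

(* Main.v *)
Require Import Defs.
From mathcomp Require Import all_boot all_order all_algebra.
From mathcomp Require Import all_classical all_reals all_analysis.
From mathcomp Require Import ring lra.

Import Order.TTheory GRing.Theory Num.Theory.
Import numFieldNormedType.Exports.

Local Open Scope classical_set_scope.
Local Open Scope ring_scope.

Set Implicit Arguments.
Unset Strict Implicit.
Unset Printing Implicit Defensive.

(** For part (1), every proper quadratic module lies in a maximal proper one,
    and these are semiorderings; so [f - a] and [b - f] positive on all
    semiorderings over [M] give sums of squares [p], [q] with
    [p (f - a) >= 1] and [q (b - f) >= 1], where [>=] is the order defined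
    by [M] (lemma [positivstellensatz]). Replacing [p] and [q] by larger
    multipliers makes them at least [1]. For [u = (f - a) / (b - a)] and
    [w = (b - a) p q] this gives [u ^ (2 ^ n) <= w] for all [n]. As [u ^ N] lies
    above its tangent [1 + N (u - 1)] at [1] for [N = 2 ^ n], with a sum of
    squares as difference, [1 - u >= - w / N]: the elements
    [(1 - u) + w / 2 ^ n] of [M] converge to [1 - u].

    Part (2) rests on order bounds, in place of functionals and measures. Let [C] be the closure
    of [M], again a quadratic module. The tangent trick also shows that [u] and
    [1 - u] multiply [C] into itself (lemma [closure_mul_one_minus]).
    Let [x] lie in the closure of every fibre [M + (f - l)], and let [V] be a
    convex zero neighborhood. By countable dimension, [V] contains an
    increasing sequence [G n] of sums of squares that dominates every element
    up to scaling (lemma [exists_exhausting]); the elements between [- G n] and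
    [G n] for some [n] form a zero neighborhood. Approximating [x] in
    the fibre over [l] up to this neighborhood, and completing a square in the
    ideal part, puts [x + 2 G n + k (f - l) ^ 2] in [M], with [n] and [k]
    depending on [l]. Compactness of [[a, b]] yields one
    [n] with [x + 3 G n + n (f - l) ^ 2] in [M] for all [l]. Averaging over the
    points [l = a + k (b - a) / j] with the Bernstein weights in [u], which
    preserve [C], replaces [(f - l) ^ 2] by
    [((b - a) ^ 2 / j) u (1 - u)], which vanishes as [j] grows. So
    [x + 3 G n] lies in [C], while [3 G n] can be taken in [V]. *)

(** * Quadratic modules of a real algebra *)

Section QuadraticModuleTheory.
Context {R : realType} {A : comAlgType R}.
Implicit Types (Q M G : set A) (f g x y p q s w : A) (k l : R).

Local Notation "k %:S" := (in_alg A k) (at level 1, format "k %:S").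

Definition sums_of_squares : set A := smallest quadratic_module set0.

Lemma scale_in_alg k x : k *: x = k%:S * x.
Proof. by rewrite mulr_algl. Qed.

Lemma half_half : 2 * 2^-1%:S = 1 :> A.
Proof. by rewrite -(rmorph_nat (in_alg A)) -rmorphM divff ?rmorph1. Qed.

Lemma difference_of_squares x :
  x = ((x + 1) * 2^-1%:S) ^+ 2 - ((x - 1) * 2^-1%:S) ^+ 2.
Proof.
transitivity ((2 * 2^-1%:S) ^+ 2 * x); last by ring.
by rewrite half_half expr1n mul1r.
Qed.

Lemma qm_square Q f : quadratic_module Q -> Q (f ^+ 2).
Proof. by case=> _ Qf Q1; rewrite -[_ ^+ 2]mulr1; exact: Qf. Qed.

Lemma qm0 Q : quadratic_module Q -> Q 0.
Proof. by move=> /(qm_square 0); rewrite expr0n. Qed.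

Lemma qm_scale Q k q : quadratic_module Q -> 0 <= k -> Q q -> Q (k%:S * q).
Proof.
by case=> _ Qf _ k0 Qq; rewrite -(sqr_sqrtr k0) rmorphXn; exact: Qf.
Qed.

Lemma qm_const Q k : quadratic_module Q -> 0 <= k -> Q k%:S.
Proof.
by move=> hQ k0; rewrite -[_%:S]mulr1; apply: qm_scale => //; case: hQ.
Qed.

Lemma quadratic_module_smallest G :
  quadratic_module (smallest (@quadratic_module A) G).
Proof.
split.
- by move=> p q Gp Gq Q [hQ GQ]; have [QD _ _] := hQ; apply: QD; [exact: Gp|exact: Gq].
- by move=> f q Gq Q [hQ GQ]; have [_ Qf _] := hQ; apply: Qf; exact: Gq.
- by move=> Q [[]].
Qed.

Lemma quadratic_module_sos : quadratic_module sums_of_squares.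
Proof. exact: quadratic_module_smallest. Qed.

Lemma sos_in_qm Q : quadratic_module Q -> sums_of_squares `<=` Q.
Proof. by move=> hQ; apply: smallest_sub => // x. Qed.

(** The elements whose multiples of [q] all lie in [Q] form a quadratic module
    themselves, so they include the sums of squares. *)
Lemma qm_multipliers Q p : quadratic_module Q -> Q p ->
  quadratic_module [set s | Q (s * p)].
Proof.
move=> [QD Qf Q1] Qp; split=> /=.
- by move=> s t Qs Qt; rewrite mulrDl; exact: QD.
- by move=> f s Qs; rewrite -mulrA; exact: Qf.
- by rewrite mul1r.
Qed.

Lemma qm_sos_mul Q s p : quadratic_module Q -> sums_of_squares s -> Q p ->
  Q (s * p).
Proof. by move=> hQ hs Qp; apply: (sos_in_qm (qm_multipliers hQ Qp)) hs. Qed.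

Lemma qm_improper Q x : quadratic_module Q -> Q (-1) -> Q x.
Proof.
move=> hQ; have [QD Qf _] := hQ => QN1; rewrite (difference_of_squares x).
by apply: QD; [exact: qm_square|rewrite -[X in Q X]mulrN1; exact: Qf].
Qed.

Lemma qm_support_mul Q g x : quadratic_module Q -> Q x -> Q (- x) -> Q (g * x).
Proof.
move=> [QD Qf _] Qx QNx; rewrite (difference_of_squares g) mulrBl.
by apply: QD; [exact: Qf|rewrite -mulrN; exact: Qf].
Qed.

Definition adjoin Q g : set A :=
  [set y | exists2 s, sums_of_squares s & Q (y - s * g)].

Lemma quadratic_module_adjoin Q g :
  quadratic_module Q -> quadratic_module (adjoin Q g).
Proof.
move=> hQ; have [QD Qf Q1] := hQ; have [SD Sf _] := quadratic_module_sos.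
split.
- move=> p q [s Ss Qp] [t St Qq]; exists (s + t); first exact: SD.
  by rewrite (_ : _ - _ = (p - s * g) + (q - t * g)); [exact: QD|ring].
- move=> f q [s Ss Qq]; exists (f ^+ 2 * s); first exact: Sf.
  by rewrite (_ : _ - _ = f ^+ 2 * (q - s * g)); [exact: Qf|ring].
- by exists 0; [exact: qm0 quadratic_module_sos|rewrite mul0r subr0].
Qed.

Lemma sub_adjoin Q g : Q `<=` adjoin Q g.
Proof.
move=> q Qq; exists 0; last by rewrite mul0r subr0.
exact: qm0 quadratic_module_sos.
Qed.

Lemma mem_adjoin Q g : quadratic_module Q -> adjoin Q g g.
Proof.
move=> hQ; exists 1; last by rewrite mul1r subrr; exact: qm0.
by case: quadratic_module_sos.
Qed.

(** * Maximal proper quadratic modules and the Positivstellensatz *)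

(** By maximality, [Q] and an element outside [Q] generate an improper quadratic
    module. Hence [g] and [-g] outside [Q] give [-1 = q1 + s1 g] and [-1 = q2 - s2 g];
    eliminating [g] puts [-s1] in [Q], so [s1 g] in [Q] and then [-1] in [Q].
    If [g] is outside [Q] but [g ^ 2] is in the support, squaring
    [- s g = 1 + q] puts [-1] in [Q]; this makes the support prime. *)
Lemma maximal_semiordering Q : quadratic_module Q -> ~ Q (-1) ->
  (forall g, ~ Q g -> adjoin Q g (-1)) -> semiordering Q.
Proof.
move=> hQ QN1 Qmax; have [QD Qf Q1] := hQ.
have Q0 := qm0 hQ.
have oppE x : opp_set Q x <-> Q (- x).
  split; first by move=> [q Qq <-]; rewrite opprK.
  by move=> Qx; exists (- x) => //; rewrite opprK.
have suppE x : (Q `&` opp_set Q) x <-> Q x /\ Q (- x).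
  by split=> -[Qx /oppE].
have suppM g x : Q x /\ Q (- x) -> Q (g * x) /\ Q (- (g * x)).
  move=> [Qx QNx]; split; first exact: qm_support_mul.
  by rewrite -mulrN; apply: qm_support_mul; rewrite ?opprK.
have total x : Q x \/ Q (- x).
  have [|/Qmax[s1 Ss1 Qq1]] := pselect (Q x); first by left.
  have [|/Qmax[s2 Ss2 Qq2]] := pselect (Q (- x)); first by right.
  exfalso; apply: QN1.
  have QNs1 : Q (- s1).
    have -> : - s1 = s2 + (s2 * (-1 - s1 * x) + s1 * (-1 - s2 * - x)) by ring.
    apply: (QD); first exact: sos_in_qm Ss2.
    by apply: (QD); exact: qm_sos_mul.
  rewrite -(subrK (s1 * x) (-1)); apply: (QD) => //; rewrite mulrC.
  by apply: qm_support_mul => //; exact: sos_in_qm Ss1.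
have radical g : Q (g ^+ 2) /\ Q (- g ^+ 2) -> Q g.
  move=> hg; have [//|/Qmax[s Ss Qq]] := pselect (Q g).
  exfalso; apply: QN1; have [_ Qi] := suppM (s ^+ 2) _ hg.
  set q := -1 - s * g in Qq.
  have -> : -1 = (1 + 1) * q + q ^+ 2 + - (s ^+ 2 * g ^+ 2) :> A.
    by rewrite /q; ring.
  apply: (QD) => //; apply: (QD); last exact: qm_square.
  by rewrite mulrDl mul1r; exact: QD.
have prime_g x y : Q (x * y) /\ Q (- (x * y)) -> ~ Q x -> Q y /\ Q (- y).
  move=> hxy /Qmax[s Ss Qq].
  have hy2 : Q (y ^+ 2) /\ Q (- y ^+ 2).
    split; first exact: qm_square.
    have [Qi _] := suppM (s * y) _ hxy.
    have -> : - y ^+ 2 = y ^+ 2 * (-1 - s * x) + s * y * (x * y) by ring.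
    by apply: (QD) => //; exact: Qf.
  by split; apply: radical => //; rewrite sqrrN.
split => //.
  by apply/seteqP; split=> // x _; have [] := total x; [left|right; apply/oppE].
split.
  split.
  - by apply/mem_set/suppE; rewrite oppr0.
  - by apply/negP => /set_mem/suppE[].
  - move=> g x y /set_mem/suppE hx /set_mem/suppE[Qy QNy].
    have [Qgx QNgx] := suppM g _ hx.
    by apply/mem_set/suppE; rewrite opprD; split; exact: QD.
move=> x y /set_mem/suppE hxy.
have [hx|nx] := pselect (Q x /\ Q (- x)).
  by apply/orP; left; exact/mem_set/suppE.
apply/orP; right; apply/mem_set/suppE.
have [Qx|] := pselect (Q x); last exact: prime_g.
apply: (@prime_g (- x)); last by move=> QNx; apply: nx.
by rewrite mulNr opprK; case: hxy.
Qed.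

Lemma exists_semiordering M : quadratic_module M -> ~ M (-1) ->
  exists Q, semiorderings_over M Q.
Proof.
move=> hM MN1.
pose proper Q := [/\ quadratic_module Q, M `<=` Q & ~ Q (-1)].
(* The union of the empty chain is empty, hence the extra alternative. *)
pose P Q := Q = set0 \/ proper Q.
have [F FP Ftot|Q [PQ Qmax]] := @Zorn_bigcup A P.
  have [[Q0 [FQ0 nQ0]]|F0] :=
      pselect (exists Q, F Q /\ Q !=set0); last first.
    left; apply/seteqP; split=> // x [Q FQ Qx]; apply: F0; exists Q.
    by split=> //; exists x.
  have properF Q x : F Q -> Q x -> proper Q.
    by move=> FQ Qx; have [Qe|//] := FP _ FQ; move: Qx; rewrite Qe.
  case: nQ0 => x0 Qx0; have [hQ0 MQ0 Q0N1] := properF _ _ FQ0 Qx0.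
  right; split.
  - split.
    + move=> p q [Q FQ Qp] [Q' FQ' Qq].
      have [[QD _ _] _ _] := properF _ _ FQ Qp.
      have [[QD' _ _] _ _] := properF _ _ FQ' Qq.
      have [QQ'|Q'Q] := Ftot _ _ FQ FQ'.
        by exists Q' => //; apply: QD' => //; exact: QQ'.
      by exists Q => //; apply: QD => //; exact: Q'Q.
    + move=> f q [Q FQ Qq]; have [[_ Qf _] _ _] := properF _ _ FQ Qq.
      by exists Q => //; exact: Qf.
    + by exists Q0 => //; case: hQ0.
  - by move=> m Mm; exists Q0 => //; exact: MQ0.
  - by move=> [Q FQ QN1]; case: (properF _ _ FQ QN1).
have [hQ MQ QN1] : proper Q.
  case: PQ => // Q0; exfalso; apply: (Qmax M); last by right; split.
  by rewrite Q0; split=> // M0; case: hM => _ _ /M0.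
exists Q; split => //; apply: maximal_semiordering => // g Qg.
have [//|nadj] := pselect (adjoin Q g (-1)).
exfalso; apply: (Qmax (adjoin Q g)).
  split; first exact: sub_adjoin.
  by move=> /(_ g) h; apply/Qg/h/mem_adjoin.
right; split => //; first exact: quadratic_module_adjoin.
by apply: subset_trans MQ _; exact: sub_adjoin.
Qed.

(** Otherwise [-g] could be adjoined to [M] without producing [-1], and some
    semiordering over [M] would contain [-g]. *)
Lemma positivstellensatz M g : quadratic_module M ->
  pos_on (semiorderings_over M) g ->
  exists2 p, sums_of_squares p & M (p * g - 1).
Proof.
move=> hM gpos; have [[p Sp Mp]|proper] := pselect (adjoin M (- g) (-1)).
  by exists p => //; rewrite (_ : _ - 1 = -1 - p * - g)//; ring.
have [Q [sQ MQ]] := exists_semiordering (quadratic_module_adjoin (- g) hM) proper.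
exfalso; have [|_ []] := gpos Q.
  by split=> //; apply: subset_trans MQ; exact: sub_adjoin.
by exists (- g); [apply/MQ/mem_adjoin|rewrite opprK].
Qed.

(** If [p g >= 1] then [p (1 + g ^ 2) >= 2 p g >= 2] and
    [p (1 + g ^ 2) g >= p g >= 1]. *)
Lemma positivstellensatz_ge1 M g : quadratic_module M ->
  pos_on (semiorderings_over M) g ->
  exists p, [/\ sums_of_squares p, M (p * g - 1) & M (p - 1)].
Proof.
move=> hM /(positivstellensatz hM)[p Sp Mpg].
have [MD Mf M1] := hM; have [SD Sf _] := quadratic_module_sos.
exists (p + g ^+ 2 * p); split; first by apply: SD => //; exact: Sf.
- have -> : (p + g ^+ 2 * p) * g - 1 =
      (p * g - 1) + (g ^+ 2 * (p * g - 1) + g ^+ 2) by ring.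
  by apply: (MD) => //; apply: (MD); [exact: Mf|exact: qm_square].
- have -> : p + g ^+ 2 * p - 1 =
      (1 - g) ^+ 2 * p + ((p * g - 1) + ((p * g - 1) + 1)) by ring.
  apply: (MD); last by apply: (MD) => //; exact: MD.
  by apply: (Mf); exact: sos_in_qm Sp.
Qed.

End QuadraticModuleTheory.

(** * Convergence and closure in the finest locally convex topology *)

Section FinestTopology.
Context {R : realType} {E : lmodType R}.
Implicit Types (U C : set E) (x w : E).

Lemma flc_base_small U w : flc_base U ->
  exists2 e : R, 0 < e & forall t, `|t| <= e -> U (t *: w).
Proof.
move=> [_ aU sU]; have [l l0 [v Uv <-]] := aU w.
exists l^-1; first by rewrite invr_gt0.
move=> t tl; apply: (sU (t * l)); last by exists v; rewrite ?scalerA.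
by rewrite normrM (gtr0_norm l0) -ler_pdivlMr// div1r.
Qed.

Lemma flc_closureP C x : flc_closure C x <->
  forall U, flc_base U -> exists2 u, U u & C (x + u).
Proof.
split=> [Cx U bU|Cx B [U bU UB]].
  have [|y [Cy [u Uu e]]] := Cx [set x + u | u in U]; first by exists U.
  by exists u; rewrite // e.
by have [u Uu Cu] := Cx _ bU; exists (x + u); split=> //; apply: UB; exists u.
Qed.

Lemma flc_cvg_line (t : nat -> R) x w : t @ \oo --> 0 ->
  (fun n => x + t n *: w : finest_lc E) @ \oo --> (x : finest_lc E).
Proof.
move=> t0 B [U bU UB]; have [e e0 Ue] := flc_base_small w bU.
have /cvgrPdist_le /(_ _ e0) := t0; apply: filterS => n.
by rewrite sub0r normrN => /Ue Uw; apply: UB; exists (t n *: w).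
Qed.

Lemma flc_seq_closure_line C (t : nat -> R) x w : t @ \oo --> 0 ->
  (forall n, C (x + t n *: w)) -> flc_seq_closure C x.
Proof.
by move=> t0 Ct; exists (fun n => x + t n *: w) => //; exact: flc_cvg_line.
Qed.

Lemma flc_closure_line C (t : nat -> R) x w : t @ \oo --> 0 ->
  (forall n, C (x + t n *: w)) -> flc_closure C x.
Proof.
move=> t0 Ct B /(flc_cvg_line w t0)[n _ Bn]; exists (x + t n *: w).
by split=> //; apply: (Bn n) => /=.
Qed.

Lemma flc_closureK C : flc_closure (flc_closure C) = flc_closure C.
Proof.
apply/esym; apply: (iffLR (@closure_id (finest_lc E) (flc_closure C))).
exact: (@closed_closure (finest_lc E)).
Qed.

End FinestTopology.

Section ClosureOfQuadraticModule.
Context {R : realType} {A : comAlgType R}.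
Implicit Types (Q M : set A) (x y w u : A).

Local Notation "k %:S" := (in_alg A k) (at level 1, format "k %:S").

(** Multiplication by [f ^ 2] is linear, hence continuous for the finest
    locally convex topology. *)
Lemma quadratic_module_closure M :
  quadratic_module M -> quadratic_module (flc_closure M).
Proof.
move=> [MD Mf M1]; split.
- move=> p q /flc_closureP Mp /flc_closureP Mq; apply/flc_closureP => U bU.
  have bU2 : flc_base [set 2^-1 *: u | u in U] by exact: flc_baseZ.
  have [u Uu Mpu] := Mp _ bU2; have [v Uv Mqv] := Mq _ bU2.
  exists (u + v); first exact: flc_base_half.
  by rewrite addrACA; exact: MD.
- move=> f q /flc_closureP Mq; apply/flc_closureP => U [/convex_setP cU aU sU].
  have [|u Uu Mqu] := Mq [set u | U (f ^+ 2 * u)]; last first.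
    by exists (f ^+ 2 * u) => //; rewrite -mulrDr; exact: Mf.
  split.
  + apply/convex_setP => x y l l01 Ux Uy /=.
    by rewrite mulrDr -!scalerAr; exact: cU.
  + move=> x; have [l l0 [v Uv e]] := aU (f ^+ 2 * x).
    exists l => //; exists (l^-1 *: x); last first.
      by rewrite scalerA divff ?scale1r ?gt_eqF.
    by rewrite /= -scalerAr -e scalerA mulVf ?scale1r ?gt_eqF.
  + move=> l l1 _ [x Ux <-] /=; rewrite -scalerAr.
    by apply: (sU l) => //; exists (f ^+ 2 * x).
- exact: subset_closure.
Qed.

(** * Elements between 0 and 1 modulo a quadratic module *)

(** A quadratic module need not be closed under products, but
    [u (1 - u) = u ^ 2 (1 - u) + (1 - u) ^ 2 u]. This gives [1 - u ^ 2], and then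
    [1 - v ^ 2 = (1 - v) + v (1 - v)] for the squares [v = u ^ (2 ^ n)]. *)
Lemma qm_one_minus_pow Q u n : quadratic_module Q -> Q u -> Q (1 - u) ->
  Q (1 - u ^+ (2 ^ n.+1)).
Proof.
move=> [QD Qf Q1] Qu Qv; elim: n => [|n IHn].
  have -> : 1 - u ^+ (2 ^ 1) = (1 - u) + (u ^+ 2 * (1 - u) + (1 - u) ^+ 2 * u).
    by rewrite expn1; ring.
  by apply: (QD) => //; apply: QD; exact: Qf.
set m := (2 ^ n)%N in IHn *.
have -> : 1 - u ^+ (2 ^ n.+2) =
    (1 - u ^+ (2 ^ n.+1)) + (u ^+ m) ^+ 2 * (1 - u ^+ (2 ^ n.+1)).
  by rewrite !expnSr -/m !exprM; ring.
by apply: (QD) => //; exact: Qf.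
Qed.

(** The tangent of [u ^ (2 ^ n)] at [1] lies below it, and the difference is a
    sum of squares by repeated squaring. *)
Lemma tangent_sos u n :
  sums_of_squares (u ^+ (2 ^ n) - 1 - (2 ^+ n)%:S * (u - 1)).
Proof.
have hS := @quadratic_module_sos R A; have [SD _ _] := hS.
elim: n => [|n IHn].
  by rewrite expr0 rmorph1 mul1r expn0 expr1 subrr; exact: qm0.
have -> : u ^+ (2 ^ n.+1) - 1 - (2 ^+ n.+1)%:S * (u - 1) =
    (u ^+ (2 ^ n) - 1) ^+ 2 +
    2%:S * (u ^+ (2 ^ n) - 1 - (2 ^+ n)%:S * (u - 1)).
  by rewrite expnSr exprM (exprS (2 : R)); ring.
by apply: SD; [exact: (qm_square _ hS)|exact: (qm_scale hS)].
Qed.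

(** [u ^ (2 ^ n) >= 1 + 2 ^ n (u - 1)], so a bound on [m u ^ (2 ^ n)] that does
    not depend on [n] bounds [m (1 - u)] below by multiples of [2 ^ - n]. *)
Lemma qm_one_minus_perturbed M m u w n : quadratic_module M -> M m ->
  M (w - u ^+ (2 ^ n.+1) * m) ->
  M ((1 - u) * m + (2 ^- n.+1) *: w).
Proof.
move=> hM Mm Mw; have [MD _ _] := hM.
have e : (2 ^- n.+1)%:S * (2 ^+ n.+1)%:S = 1 :> A.
  by rewrite -rmorphM mulVf ?rmorph1// expf_neq0.
have -> : (1 - u) * m + (2 ^- n.+1) *: w = (2 ^- n.+1)%:S *
    ((w - u ^+ (2 ^ n.+1) * m) + (m +
     (u ^+ (2 ^ n.+1) - 1 - (2 ^+ n.+1)%:S * (u - 1)) * m)).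
  rewrite scale_in_alg; move: e; set t := (2 ^- n.+1)%:S; set T := (2 ^+ n.+1)%:S => e.
  clearbody t T; ring: e.
apply: qm_scale => //.
by do 2 apply: (MD) => //; apply: qm_sos_mul => //; exact: tangent_sos.
Qed.

Lemma cvg_geometric_half : (fun n => 2 ^- n.+1 : R) @ \oo --> (0 : R).
Proof.
have /cvg_expr : `|2^-1 : R| < 1.
  by rewrite ger0_norm// invf_lt1// ltr1n.
rewrite -cvg_shiftS; rewrite (_ : [sequence _]_n = fun n => 2 ^- n.+1)//.
by apply/funext => n /=; rewrite exprVn.
Qed.

(** For squares [s ^ 2], [s ^ 2 u ^ (2 ^ n) <= s ^ 2]. A general [m] is at most
    [((m + 1) / 2) ^ 2], so this square bounds all the [m u ^ (2 ^ n)]. *)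
Lemma closure_mul_one_minus M u m : quadratic_module M ->
  flc_closure M u -> flc_closure M (1 - u) -> flc_closure M m ->
  flc_closure M ((1 - u) * m).
Proof.
move=> hM Cu Cv Cm; have hC := quadratic_module_closure hM.
have [CD Cf _] := hC.
rewrite -flc_closureK.
apply: (flc_closure_line cvg_geometric_half (w := ((m + 1) * 2^-1%:S) ^+ 2)).
move=> n; apply: (qm_one_minus_perturbed hC Cm).
rewrite [X in _ - _ * X](difference_of_squares m).
set s := (m + 1) * _; set t := (m - 1) * _.
have -> : s ^+ 2 - u ^+ (2 ^ n.+1) * (s ^+ 2 - t ^+ 2) =
    s ^+ 2 * (1 - u ^+ (2 ^ n.+1)) + (u ^+ (2 ^ n) * t) ^+ 2.
  by rewrite expnSr exprM; ring.
apply: CD; last exact: (qm_square _ hC).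
by apply: Cf; exact: (qm_one_minus_pow _ hC).
Qed.

End ClosureOfQuadraticModule.

(** * Countable dimension *)

Section CountableDimension.
Context {R : realType} {E : lmodType R}.

(** A spanning sequence, in the form of the induction principle it provides. *)
Lemma countable_dimension_ind : countable_dimension E ->
  exists e : nat -> E, forall P : E -> Prop, P 0 ->
    (forall x y, P x -> P y -> P (x + y)) ->
    (forall (k : R) x, P x -> P (k *: x)) -> (forall n, P (e n)) -> forall x, P x.
Proof.
move=> [B [/countable_injP[r r_inj] _ B_span]].
exists (fun n => xget 0 [set b | B b /\ r b = n]) => P P0 PD PZ Pe x.
have [s [c [sB ->]]] := B_span x.
rewrite big_seq; apply: (big_ind P) => // v /sB Bv; apply: PZ.
have [Be re] : [set b | B b /\ r b = r v] (xget 0 [set b | B b /\ r b = r v]).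
  by apply: (xgetI _ (x := v)).
by rewrite -(r_inj _ _ (mem_set Be) (mem_set Bv) re); exact: Pe.
Qed.

Lemma flc_base_weighted_sum (V : set E) (v : nat -> E) n : flc_base V ->
  (forall i, V (v i)) -> V (\sum_(i < n) (2 ^- i.+1 : R) *: v i).
Proof.
move=> bV; have [/convex_setP cV _ _] := bV.
elim: n v => [|n IHn] v Vv; first by rewrite big_ord0; exact: flc_base0.
rewrite big_ord_recl expr1.
have -> : \sum_(i < n) (2 ^- (lift ord0 i).+1 : R) *: v (lift ord0 i) =
    (1 - 2^-1) *: \sum_(i < n) (2 ^- i.+1 : R) *: v i.+1.
  rewrite scaler_sumr; apply: eq_bigr => i _; rewrite scalerA; congr (_ *: _).
  by rewrite lift0 (exprS 2 i.+1) invfM; congr (_ * _); lra.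
apply: cV; [|exact: Vv|exact: (IHn (fun i => v i.+1))].
by apply/andP; split; lra.
Qed.

End CountableDimension.

Section FibreTheorem.
Context {R : realType} {A : comAlgType R}.
Implicit Types (V M : set A) (G : nat -> A) (x y f g u : A).

Local Notation "k %:S" := (in_alg A k) (at level 1, format "k %:S").
Local Notation sos := (@sums_of_squares R A).

(** A countable cofinal scale for the order given by sums of squares: every
    element is dominated, in both directions, by a multiple of some [G n]. *)
Definition exhausting G : Prop :=
  (forall m n, (m <= n)%N -> sos (G n - G m)) /\
  (forall x, exists k n,
     [/\ 0 < k, sos (k%:S * G n - x) & sos (k%:S * G n + x)]).

(** Each spanning vector is a difference [s ^ 2 - t ^ 2], hence lies between
    [- (s ^ 2 + t ^ 2)] and [s ^ 2 + t ^ 2]. The partial sums of these bounds,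
    with weights small enough to stay in [V], dominate all spanning vectors. *)
Lemma exists_exhausting V : countable_dimension A -> flc_base V ->
  exists2 G, exhausting G & forall n, V (G n).
Proof.
have hS := @quadratic_module_sos R A; have [SD Sf _] := hS.
move=> /countable_dimension_ind[e e_ind] bV.
have [_ aV _] := bV.
pose s n := (e n + 1) * 2^-1%:S; pose t n := (e n - 1) * 2^-1%:S.
have eE n : e n = s n ^+ 2 - t n ^+ 2 by exact: difference_of_squares.
have /choice[k kP] n :
    exists k : R, 0 < k /\ V (k *: (s n ^+ 2 + t n ^+ 2)).
  have [l l0 [v Vv <-]] := aV (s n ^+ 2 + t n ^+ 2).
  by exists l^-1; rewrite invr_gt0 scalerA mulVf ?gt_eqF// scale1r.
pose G n := \sum_(i < n) (2 ^- i.+1 : R) *: (k i *: (s i ^+ 2 + t i ^+ 2)).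
have GS n : G n.+1 = G n + (2 ^- n.+1 * k n)%:S * (s n ^+ 2 + t n ^+ 2).
  by rewrite /G big_ord_recr/= scalerA mulr_algl.
have k0 n : 0 < 2 ^- n.+1 * k n.
  by rewrite mulr_gt0 ?invr_gt0 ?exprn_gt0//; have [] := kP n.
have G_mono m n : (m <= n)%N -> sos (G n - G m).
  move=> /subnK <-; elim: (n - m)%N => [|d IHd]; first by rewrite subrr; exact: qm0.
  rewrite addSn GS addrAC; apply: (SD) => //.
  apply: (qm_scale hS); first exact: ltW.
  by apply: (SD); [exact: (qm_square (s _) hS)|exact: (qm_square (t _) hS)].
have G_sos n : sos (G n) by have := G_mono _ _ (leq0n n); rewrite /G big_ord0 subr0.
exists G; last first.
  by move=> n; exact: (flc_base_weighted_sum n bV (fun i => proj2 (kP i))).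
split=> //; apply: e_ind.
- by exists 1, 0; rewrite addr0 subr0 rmorph1 mul1r; split.
- move=> x y [p [m [p0 pm_x pmx]]] [q [n [q0 qn_y qny]]].
  exists (p + q), (maxn m n); have Sm := G_mono _ _ (leq_maxl m n).
  have Sn := G_mono _ _ (leq_maxr m n).
  have S0 : sos (p%:S * (G (maxn m n) - G m) + q%:S * (G (maxn m n) - G n)).
    by apply: SD; apply: (qm_scale hS) => //; exact: ltW.
  split; first exact: addr_gt0.
  + have := SD _ _ S0 (SD _ _ pm_x qn_y); congr sos; ring.
  + have := SD _ _ S0 (SD _ _ pmx qny); congr sos; ring.
- move=> c x [p [n [p0 pn_x pnx]]]; exists (p * (`|c| + 1)), n.
  have S0 : sos (p%:S * G n) by apply: (qm_scale hS) => //; exact: ltW.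
  have c1 : 0 < `|c| + 1 by rewrite ltr_wpDl.
  split; first exact: mulr_gt0.
  + have [c0|c0] := leP 0 c.
      have := SD _ _ S0 (qm_scale hS c0 pn_x); congr sos.
      by rewrite (ger0_norm c0) scale_in_alg; ring.
    have := SD _ _ S0 (qm_scale hS (ltW (_ : 0 < - c)) pnx).
    rewrite oppr_gt0 => /(_ c0); congr sos.
    by rewrite (ltr0_norm c0) scale_in_alg; ring.
  + have [c0|c0] := leP 0 c.
      have := SD _ _ S0 (qm_scale hS c0 pnx); congr sos.
      by rewrite (ger0_norm c0) scale_in_alg; ring.
    have := SD _ _ S0 (qm_scale hS (ltW (_ : 0 < - c)) pn_x).
    rewrite oppr_gt0 => /(_ c0); congr sos.
    by rewrite (ltr0_norm c0) scale_in_alg; ring.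
- move=> n; have := GS n; have := k0 n; set c := 2 ^- n.+1 * k n => c0 GSn.
  exists c^-1, n.+1; rewrite GSn invr_gt0 c0 eE.
  have ce : c^-1%:S * c%:S = 1 :> A by rewrite -rmorphM mulVf ?rmorph1 ?gt_eqF.
  have S0 : sos (c^-1%:S * G n).
    by apply: (qm_scale hS) => //; rewrite invr_ge0 ltW.
  have Ss := qm_square (s n) hS; have St := qm_square (t n) hS.
  split=> //.
  + have := SD _ _ S0 (SD _ _ St St); congr sos.
    by rewrite mulrDr mulrA ce; ring.
  + have := SD _ _ S0 (SD _ _ Ss Ss); congr sos.
    by rewrite mulrDr mulrA ce; ring.
Qed.

(** * Approximation in the fibres *)

(** The unit ball of the order generated by [G]; as a zero neighborhood it turns
    topological errors into order bounds. *)
Definition exhausted_ball G : set A :=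
  [set x | exists n, sos (G n - x) /\ sos (G n + x)].

Lemma flc_base_exhausted_ball G : exhausting G -> flc_base (exhausted_ball G).
Proof.
move=> [G_mono G_abs].
have hS := @quadratic_module_sos R A; have [SD _ _] := hS.
have cB x y (l : R) : 0 <= l <= 1 ->
    exhausted_ball G x -> exhausted_ball G y ->
    exhausted_ball G (l *: x + (1 - l) *: y).
  move=> /andP[l0 l1] [m [m_x mx]] [n [n_y ny]].
  have l1' : 0 <= 1 - l by rewrite subr_ge0.
  have S0 : sos (l%:S * (G (maxn m n) - G m) + (1 - l)%:S * (G (maxn m n) - G n)).
    by apply: (SD); apply: (qm_scale hS) => //; apply: G_mono;
      rewrite ?leq_maxl ?leq_maxr.
  exists (maxn m n); rewrite !scale_in_alg; split.
    have := SD _ _ S0 (SD _ _ (qm_scale hS l0 m_x) (qm_scale hS l1' n_y)).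
    by congr sos; ring.
  have := SD _ _ S0 (SD _ _ (qm_scale hS l0 mx) (qm_scale hS l1' ny)).
  by congr sos; ring.
split.
- exact/convex_setP.
- move=> x; have [k [n [k0 kn_x knx]]] := G_abs x.
  exists k => //; exists (k^-1 *: x); last by rewrite scalerA divff ?scale1r ?gt_eqF.
  have ke : k^-1%:S * k%:S = 1 :> A by rewrite -rmorphM mulVf ?rmorph1 ?gt_eqF.
  have k0' : 0 <= k^-1 by rewrite invr_ge0 ltW.
  exists n; rewrite scale_in_alg; split.
    have := qm_scale hS k0' kn_x; congr sos.
    by rewrite mulrBr mulrA ke mul1r.
  have := qm_scale hS k0' knx; congr sos.
  by rewrite mulrDr mulrA ke mul1r.
- move=> l; rewrite ler_norml => /andP[lN1 l1] _ [x Bx <-].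
  have BNx : exhausted_ball G (- x).
    by case: Bx => n [n_x nx]; exists n; rewrite opprK.
  have := cB x (- x) ((1 + l) / 2) _ Bx BNx.
  rewrite scalerN -scaleNr -scalerDl (_ : (1 + l) / 2 + _ = l); last by field.
  by apply; apply/andP; split; lra.
Qed.

Lemma ideal_gen_multiple g x : ideal_gen g x -> exists h, x = g * h.
Proof.
move=> gx; apply: (@smallest_sub _ _ _ [set x | exists h, x = g * h]) gx.
  split.
  - by exists 0; rewrite mulr0.
  - by move=> _ _ [h ->] [k ->]; exists (h + k); rewrite mulrDr.
  - by move=> y _ [h ->]; exists (y * h); rewrite mulrCA.
by move=> _ ->; exists 1; rewrite mulr1.
Qed.

(** The exhaustion dominates both the error of the approximation of [x] and a
    multiple of [h ^ 2], where [(f - l) h] is the part of the approximant in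
    the ideal; completing the square in [(f - l) h] costs a multiple of
    [(f - l) ^ 2]. *)
Lemma fibre_bound M G f (l : R) x : quadratic_module M -> exhausting G ->
  flc_closure (add_ideal_gen M (f - l%:A)) x ->
  exists n (k : R), 0 <= k /\ M (x + 2%:S * G n + k%:S * (f - l%:S) ^+ 2).
Proof.
move=> hM hG /flc_closureP/(_ _ (flc_base_exhausted_ball hG)).
have [G_mono G_abs] := hG; have [MD _ _] := hM.
have MS y : sos y -> M y by move=> /(sos_in_qm hM).
move=> [u [m [m_u _]] [q Mq [i /ideal_gen_multiple[h ->] e]]].
have [c [n [c0 cn_h _]]] := G_abs (h ^+ 2).
pose d := maxn m n; pose k := c / 4.
exists d, k; split; first by rewrite divr_ge0 ?ltW.
have ck : c%:S = 4%:S * k%:S :> A by rewrite -rmorphM; congr (_%:S); rewrite /k; field.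
have ce : c^-1%:S * (4%:S * k%:S) = 1 :> A.
  by rewrite -ck -rmorphM mulVf ?rmorph1 ?gt_eqF.
have c0' : 0 <= c^-1 by rewrite invr_ge0 ltW.
have -> : x + 2%:S * G d + k%:S * (f - l%:S) ^+ 2 =
    q + ((G m - u) + (c^-1%:S * (c%:S * G n - h ^+ 2) +
      (c^-1%:S * (h + 2%:S * k%:S * (f - l%:S)) ^+ 2 +
       ((G d - G m) + (G d - G n))))).
  have -> : x = q + (f - l%:S) * h - u by rewrite /= e addrK.
  rewrite ck; move: (f - l%:S) => g.
  move: ce; move: k%:S c^-1%:S => K C ce.
  apply/eqP; rewrite -subr_eq0; apply/eqP.
  transitivity ((1 - C * (4%:S * K)) * (G n + g * h + K * g ^+ 2)); first by ring.
  by rewrite ce subrr mul0r.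
apply: (MD) => //; apply: (MD); first exact: MS.
apply: (MD); first by apply: (qm_scale hM) => //; exact: MS.
apply: (MD); first by apply: (qm_scale hM) => //; exact: qm_square.
by apply: (MD); apply: MS; apply: G_mono; rewrite /d ?leq_maxl ?leq_maxr.
Qed.

(** * Gluing the fibres *)

(** A bound valid at [l0] persists near [l0] when the coefficients grow: since
    [(f - l0) ^ 2 <= 2 (f - l) ^ 2 + 2 (l - l0) ^ 2], only the constant
    [2 k (l - l0) ^ 2] is left, and the exhaustion absorbs it. *)
Lemma uniform_fibre_bound M G f x (a b : R) :
  quadratic_module M -> exhausting G ->
  (forall l, a <= l <= b -> exists n (k : R),
     0 <= k /\ M (x + 2%:S * G n + k%:S * (f - l%:S) ^+ 2)) ->
  exists n, forall l, a <= l <= b ->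
    M (x + 3%:S * G n + n%:R%:S * (f - l%:S) ^+ 2).
Proof.
move=> hM hG loc; have [G_mono G_abs] := hG; have [MD _ _] := hM.
have MS y : sos y -> M y by move=> /(sos_in_qm hM).
pose P n l := M (x + 3%:S * G n + n%:R%:S * (f - l%:S) ^+ 2).
(* A near-covering with respect to [n] gives one [n] for the whole segment. *)
suff [n _ nP] : \forall n \near \oo, `[a, b]%classic `<=` P n.
  by exists n => l lab; apply: (nP n (leqnn n)); rewrite /= in_itv.
apply: (iffLR (compact_near_coveringP `[a, b]%classic)).
  exact: segment_compact.
move=> l0; rewrite /= in_itv => /loc[m [k [k0 Mk]]]; have [c [p [c0 cp1 _]]] := G_abs 1.
(* For [r = `|l - l0| < d], [r ^ 2 <= r] and [2 k c r <= 1], so [2 k r ^ 2 <= 1 / c]. *)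
pose d : R := Num.min 1 (2 * k * c + 1)^-1.
have kc0 : 0 <= k * c by rewrite mulr_ge0// ltW.
have kc1 : 0 < 2 * k * c + 1 by nra.
have d0 : 0 < d by rewrite lt_min ltr01 invr_gt0.
have [K kK] : exists K : nat, 2 * k <= K%:R.
  exists (Num.trunc (2 * k)).+1; apply: ltW; exact: truncnS_gt.
exists (ball l0 d, [set n | (maxn K (maxn m p) <= n)%N]).
  split => /=; first exact: nbhsx_ballx.
  by exists (maxn K (maxn m p)).
move=> [l n] /= [ld]; rewrite !geq_max => /and3P[Kn mn pn].
have kd : 2 * k * (l - l0) ^+ 2 <= c^-1.
  rewrite -[leRHS]mul1r ler_pdivlMr//.
  have : `|l - l0| < d by rewrite distrC.
  set r := `|l - l0| => rd; have r0 : 0 <= r by exact: normr_ge0.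
  have r1 : r < 1 by apply: lt_le_trans rd _; rewrite /d ge_min lexx.
  have rkc : r * (2 * k * c + 1) <= 1.
    rewrite -ler_pdivlMr// div1r; apply: (le_trans (ltW rd)).
    by rewrite /d ge_min lexx orbT.
  rewrite -real_normK ?num_real// -/r; nra.
rewrite /P.
have -> : x + 3%:S * G n + n%:R%:S * (f - l%:S) ^+ 2 =
    (x + 2%:S * G m + k%:S * (f - l0%:S) ^+ 2) +
    (2%:S * (G n - G m) + ((G n - G p) +
     (c^-1%:S * (c%:S * G p - 1) + ((c^-1 - 2 * k * (l - l0) ^+ 2)%:S +
     ((n%:R - 2 * k)%:S * (f - l%:S) ^+ 2 +
      k%:S * (f - 2%:S * l%:S + l0%:S) ^+ 2))))).
  have ce : c^-1%:S * c%:S = 1 :> A by rewrite -rmorphM mulVf ?rmorph1 ?gt_eqF.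
  apply/eqP; rewrite -subr_eq0; apply/eqP.
  transitivity ((1 - c^-1%:S * c%:S) * G p); first by ring.
  by rewrite ce subrr mul0r.
apply: (MD) => //; apply: (MD).
  by apply: (qm_scale hM) => //; apply: MS; exact: G_mono.
apply: (MD); first by apply: MS; exact: G_mono.
apply: (MD).
  by apply: (qm_scale hM); [rewrite invr_ge0 ltW|exact: MS].
apply: (MD); first by apply: (qm_const hM); rewrite subr_ge0.
apply: (MD); apply: (qm_scale hM) => //; try exact: (qm_square _ hM).
by rewrite subr_ge0 (le_trans kK)// ler_nat.
Qed.

(** The convex combination of the hypotheses with the Bernstein weights
    ['C(n, k) u ^ k (1 - u) ^ (n - k)], i.e. the variance of the binomial
    distribution, organised by Pascal's rule. *)
Lemma bernstein_combination (C : set A) f u z t p d n :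
  (forall x y, C x -> C y -> C (x + y)) ->
  (forall x, C x -> C (u * x)) -> (forall x, C x -> C ((1 - u) * x)) ->
  (forall k, (k <= n)%N -> C (z + t * (f - (p + k%:R * d)) ^+ 2)) ->
  C (z + t * ((f - p - n%:R * d * u) ^+ 2 + n%:R * d ^+ 2 * u * (1 - u))).
Proof.
move=> CD Cu Cv; elim: n p => [|n IHn] p hC.
  by have := hC 0 (leqnn 0); congr C; ring.
have Cp := IHn p (fun k kn => hC k (leqW kn)).
have Cpd : C (z + t * ((f - (p + d) - n%:R * d * u) ^+ 2 +
    n%:R * d ^+ 2 * u * (1 - u))).
  apply: IHn => k kn; have := hC k.+1 kn; congr C.
  by rewrite -(natr1 k); ring.
have := CD _ _ (Cv _ Cp) (Cu _ Cpd); congr C.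
by rewrite -(natr1 n); ring.
Qed.

(** * The fibre theorem *)

Lemma affine_coordinate f (a b : R) : a < b ->
  let u := (b - a)^-1%:S * (f - a%:S) in
  1 - u = (b - a)^-1%:S * (b%:S - f) /\ f - a%:S = (b - a)%:S * u.
Proof.
move=> ab u; have ce : (b - a)^-1%:S * (b - a)%:S = 1 :> A.
  by rewrite -rmorphM mulVf ?rmorph1// subr_eq0 gt_eqF.
split; last by rewrite /u mulrA [_ * _^-1%:S]mulrC ce mul1r.
by rewrite -[X in X - u]ce /u -mulrBr; congr (_ * _); ring.
Qed.

(** Let [p (f - a) >= 1] and [q (b - f) >= 1] with [p, q >= 1]. Multiplying the
    first by [q], the second by [p] and adding gives [(b - a) p q >= 2]. As
    [p q u] and [p q (1 - u)] lie in [M], so does [p q (1 - u ^ (2 ^ n))], and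
    [(b - a) p q] bounds all [u ^ (2 ^ n)]. *)
Lemma seq_closure_of_bounded M f (a b : R) : quadratic_module M ->
  pos_on (semiorderings_over M) (f - a%:S) ->
  pos_on (semiorderings_over M) (b%:S - f) ->
  flc_seq_closure M (b%:S - f).
Proof.
move=> hM /(positivstellensatz_ge1 hM)[p [Sp Mp Mp1]].
move=> /(positivstellensatz_ge1 hM)[q [Sq Mq Mq1]].
have [MD Mf M1] := hM.
have Mpq : M ((b - a)%:S * (p * q) - 2%:S).
  have -> : (b - a)%:S * (p * q) - 2%:S =
     q * (p * (f - a%:S) - 1) + (p * (q * (b%:S - f) - 1) +
     ((p - 1) + (q - 1))) by ring.
  apply: (MD); first exact: qm_sos_mul.
  by apply: (MD); [exact: qm_sos_mul|exact: MD].
have Mpp : M (p * q) by apply: qm_sos_mul => //; exact: sos_in_qm Sq.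
(* The hypotheses then force [p q (b - a) >= 2] with [b - a <= 0]. *)
have [ba|ab] := leP b a.
  have MN1 : M (-1).
    have -> : -1 = 2^-1%:S * (((b - a)%:S * (p * q) - 2%:S) +
        (a - b)%:S * (p * q)).
      have h : 2^-1%:S * 2%:S = 1 :> A by rewrite -rmorphM mulVf ?rmorph1.
      by rewrite -{1}h; ring.
    apply: (qm_scale hM) => //; apply: (MD) => //.
    by apply: (qm_scale hM) => //; rewrite subr_ge0.
  exists (fun=> b%:S - f); first by move=> _; exact: qm_improper.
  exact: cvg_cst.
set c := b - a; have c0 : 0 < c by rewrite subr_gt0.
have c0' : 0 <= c^-1 by rewrite invr_ge0 ltW.
have [] := affine_coordinate f ab; rewrite -/c; set u := c^-1%:S * (f - a%:S).
move=> vE _.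
have ce : c^-1%:S * c%:S = 1 :> A by rewrite -rmorphM mulVf ?rmorph1 ?gt_eqF.
pose N := [set s | M (s * (p * q))].
have hN : quadratic_module N by exact: qm_multipliers.
have Nu : N u.
  rewrite /N /u /= -mulrA; apply: (qm_scale hM) => //.
  have -> : (f - a%:S) * (p * q) = q * (p * (f - a%:S) - 1) + q by ring.
  by apply: (MD); [exact: qm_sos_mul|exact: sos_in_qm Sq].
have Nv : N (1 - u).
  rewrite /N /= vE -mulrA; apply: (qm_scale hM) => //.
  have -> : (b%:S - f) * (p * q) = p * (q * (b%:S - f) - 1) + p by ring.
  by apply: (MD); [exact: qm_sos_mul|exact: sos_in_qm Sp].
have Mw n : M (c%:S * (p * q) - u ^+ (2 ^ n.+1) * 1).
  have -> : c%:S * (p * q) - u ^+ (2 ^ n.+1) * 1 =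
      c%:S * ((1 - u ^+ (2 ^ n.+1)) * (p * q)) +
      (u ^+ (2 ^ n)) ^+ 2 * ((c%:S * (p * q) - 2%:S) + 1).
    by rewrite expnSr exprM; ring.
  apply: (MD); last by apply: (Mf); exact: (MD).
  apply: (qm_scale hM); first exact: ltW.
  exact: (qm_one_minus_pow _ hN Nu Nv).
apply: (flc_seq_closure_line cvg_geometric_half
  (w := c%:S * (c%:S * (p * q)))) => n.
have -> : b%:S - f = c%:S * ((1 - u) * 1).
  by rewrite mulr1 vE mulrA [_ * _^-1%:S]mulrC ce mul1r.
rewrite scale_in_alg [_ * (c%:S * _)]mulrCA -mulrDr.
apply: (qm_scale hM); first exact: ltW.
rewrite -(scale_in_alg (2 ^- n.+1)).
exact: (qm_one_minus_perturbed hM M1 (Mw n)).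
Qed.

Lemma closure_add_ideal_gen M g :
  flc_closure M `<=` flc_closure (add_ideal_gen M g).
Proof.
apply: (@closure_subset (finest_lc A)) => m Mm.
exists m => //; exists 0; last by rewrite addr0.
by move=> I [[]].
Qed.

(** Bernstein weights are products of powers of [u = (f - a) / (b - a)] and
    [1 - u], which act on the closure of [M]; with [j] steps they turn the
    hypothesis into [z + (k (b - a) ^ 2 / j) u (1 - u)], a line tending to [z]. *)
Lemma closure_of_uniform_bound M f (a b : R) z (k : R) :
  quadratic_module M -> a <= b ->
  flc_closure M (b%:S - f) -> flc_closure M (f - a%:S) ->
  (forall l, a <= l <= b -> flc_closure M (z + k%:S * (f - l%:S) ^+ 2)) ->
  flc_closure M z.
Proof.
move=> hM; rewrite le_eqVlt => /orP[/eqP <-|ab] Cbf Cfa Cz;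
    have hC := quadratic_module_closure hM; have [CD _ _] := hC.
  (* Now [f - a] and its opposite lie in the closure, hence its multiples. *)
  have -> : z = (z + k%:S * (f - a%:S) ^+ 2) +
      (- (k%:S * (f - a%:S))) * (f - a%:S) by ring.
  apply: CD; first by apply: Cz; rewrite lexx.
  by apply: (qm_support_mul _ hC) => //; rewrite opprB.
set c := b - a; have c0 : 0 < c by rewrite subr_gt0.
have c0' : 0 <= c^-1 by rewrite invr_ge0 ltW.
have [] := affine_coordinate f ab; rewrite -/c; set u := c^-1%:S * (f - a%:S).
move=> vE uE.
have Cu : flc_closure M u by exact: (qm_scale hC).
have Cv : flc_closure M (1 - u) by rewrite vE; exact: (qm_scale hC).
have Cmv y : flc_closure M y -> flc_closure M ((1 - u) * y).
  exact: closure_mul_one_minus.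
have Cmu y : flc_closure M y -> flc_closure M (u * y).
  move=> Cy; rewrite -(subKr 1 u); apply: closure_mul_one_minus => //.
  by rewrite subKr.
rewrite -flc_closureK.
apply: (flc_closure_line cvg_harmonic
  (w := (k * c ^+ 2)%:S * (u * (1 - u)))) => j.
pose d : R := c / j.+1%:R.
have jd : j.+1%:R * d = c by rewrite /d mulrC divfK.
have := @bernstein_combination (flc_closure M) f u z
  k%:S a%:S d%:S j.+1 CD Cmu Cmv.
have -> : f - a%:S - j.+1%:R * d%:S * u = 0.
  by rewrite -(rmorph_nat (in_alg A)) -rmorphM jd uE subrr.
rewrite scale_in_alg.
have -> : k%:S * (0 ^+ 2 + j.+1%:R * d%:S ^+ 2 * u * (1 - u)) =
    (harmonic j)%:S * ((k * c ^+ 2)%:S * (u * (1 - u))).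
  have dE : harmonic j * (k * c ^+ 2) = k * (j.+1%:R * d ^+ 2).
    have : j.+1%:R != 0 :> R by rewrite pnatr_eq0.
    by rewrite /= -jd; move: j.+1%:R => N N0; field.
  by rewrite [RHS]mulrA -rmorphM dE; ring.
apply=> i ij; have := Cz (a + i%:R * d).
have -> : (a + i%:R * d)%:S = a%:S + i%:R * d%:S by ring.
apply.
have id : 0 <= i%:R * d <= c.
  rewrite -jd ler_pM2r ?divr_gt0// ler_nat ij andbT.
  by rewrite mulr_ge0// divr_ge0// ltW.
by rewrite lerDl -lerBrDl.
Qed.

(** The factor [3] in front of [G n] is absorbed by exhausting [3 ^-1 V]. *)
Lemma closure_of_fibre_closures M f (a b : R) x : quadratic_module M ->
  countable_dimension A -> a <= b ->
  flc_closure M (b%:S - f) -> flc_closure M (f - a%:S) ->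
  (forall l, a <= l <= b -> flc_closure (add_ideal_gen M (f - l%:A)) x) ->
  flc_closure M x.
Proof.
move=> hM cA ab Cbf Cfa xl.
rewrite -flc_closureK; apply/flc_closureP => V bV.
have bV3 : flc_base [set 3^-1 *: v | v in V] by exact: flc_baseZ.
have [G hG VG] := exists_exhausting cA bV3.
have [n Mn] :=
  uniform_fibre_bound hM hG (fun l lab => fibre_bound hM hG (xl l lab)).
exists (3%:S * G n).
  by have [v Vv <-] := VG n; rewrite -scale_in_alg scalerA divff ?scale1r.
apply: (closure_of_uniform_bound hM ab Cbf Cfa) => l lab.
by apply: subset_closure; exact: Mn.
Qed.

End FibreTheorem.

Theorem theorem2p8 (R : realType) (A : comAlgType R) (M : set A)
    (hM : quadratic_module M) (f : A) (a b : R) :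
  (pos_on (semiorderings_over M) (f - a%:A) ->
   pos_on (semiorderings_over M) (b%:A - f) ->
   flc_seq_closure M (b%:A - f) /\ flc_seq_closure M (f - a%:A))
  /\
  (countable_dimension A ->
   flc_closure M (b%:A - f) -> flc_closure M (f - a%:A) ->
   flc_closure M =
   \bigcap_(l in `[a, b]) flc_closure (add_ideal_gen M (f - l%:A))).
Proof.
split.
  move=> fa bf; split; first exact: seq_closure_of_bounded fa bf.
  have eb : - f - in_alg A (- b) = b%:A - f by rewrite rmorphN opprK addrC.
  have ea : in_alg A (- a) - - f = f - a%:A by rewrite rmorphN opprK addrC.
  rewrite -ea; apply: (@seq_closure_of_bounded _ _ M (- f) (- b)) => //.
    by rewrite eb.
  by rewrite ea.
move=> cA Cbf Cfa; have hC := quadratic_module_closure hM.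
have [CD Cf _] := hC.
apply/seteqP; split=> [x Cx l _|x xl]; first exact: closure_add_ideal_gen.
have [ab|ba] := leP a b.
  apply: (closure_of_fibre_closures hM cA ab Cbf Cfa) => l lab.
  by apply: xl; rewrite /= in_itv.
(* For [b < a] the sum of [b - f] and [f - a] is a negative constant. *)
apply: (qm_improper _ hC).
have -> : -1 = in_alg A (a - b)^-1 * ((b%:A - f) + (f - a%:A)).
  rewrite addrA subrK -scalerBl -scale_in_alg scalerA -[b - a]opprB mulrN.
  by rewrite mulVf ?scaleN1r// subr_eq0 gt_eqF.
apply: (qm_scale hC); last exact: CD.
by rewrite invr_ge0 subr_ge0 ltW.
Qed.
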